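(* Let $f:\mathbb{N}\to\mathbb{R}$ be a bounded arithmetic function. Then $f$ has asymptotically independent summands with exponent $O(1/n)$, that is, $$\frac{\sum_{i=1}^{n}\sum_{j=1,\,j\ne i}^{n} f(i)f(j)}{n(n-1)}-\frac{\left(\sum_{k=1}^{n} f(k)\right)^2-\sum_{k=1}^{n} f^2(k)}{n^2}=O(1/n)\qquad (n\to\infty).$$
   Context: For an arithmetic function $f$, the average value of the product of $f$ at different values of the argument is $\frac{1}{n(n-1)}\sum_{i=1}^{n}\sum_{j=1,\,j\ne i}^{n} f(i)f(j)$, and the product of the average values of $f$ for different values of the argument is $\frac{1}{n^2}\left(\left(\sum_{k=1}^{n} f(k)\right)^2-\sum_{k=1}^{n} f^2(k)\right)$. Asymptotic independence of the summands $f(k)$ means that the difference of these two quantities tends to $0$ as $n\to\infty$; the exponent (indicator) of asymptotic independence is an asymptotic upper bound for this difference. *)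

(* Defs.v *)
From mathcomp Require Import all_boot all_order all_algebra.
From mathcomp Require Import all_classical all_reals all_analysis.

Set Implicit Arguments.
Unset Strict Implicit.
Unset Printing Implicit Defensive.

Import Order.TTheory GRing.Theory Num.Theory.
Import numFieldNormedType.Exports.

Local Open Scope classical_set_scope.
Local Open Scope ring_scope.

(* An arithmetic function is a function on the positive integers; it is encoded
   as f : nat -> R whose value at 0 is never used. *)
Definition bounded_arith (R : realType) (f : nat -> R) : Prop :=
  [bounded f k | k in [set k : nat | (0 < k)%N]].

(* For n <= 1 the denominator is 0, so the value is 0 by the convention
   0^-1 = 0; only the behaviour as n tends to infinity matters. *)
Definition average_of_product (R : realType) (f : nat -> R) (n : nat) : R :=
  (\sum_(1 <= i < n.+1) \sum_(1 <= j < n.+1 | j != i) f i * f j)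
    / (n%:R * (n%:R - 1)).

Definition product_of_averages (R : realType) (f : nat -> R) (n : nat) : R :=
  ((\sum_(1 <= k < n.+1) f k) ^+ 2 - \sum_(1 <= k < n.+1) f k ^+ 2)
    / n%:R ^+ 2.

Definition independence_gap (R : realType) (f : nat -> R) (n : nat) : R :=
  average_of_product f n - product_of_averages f n.

Definition asymptotically_independent (R : realType) (f : nat -> R) : Prop :=
  independence_gap f n @[n --> \oo] --> (0 : R).

Definition asymptotically_independent_with_exponent
    (R : realType) (f e : nat -> R) : Prop :=
  asymptotically_independent f /\ independence_gap f =O_\oo e.

(* Main.v *)
Require Import Defs.
From mathcomp Require Import all_boot all_order all_algebra.
From mathcomp Require Import all_classical all_reals all_analysis.
From mathcomp Require Import ring.

(** Write [P] for the sum of [f i * f j] over the ordered pairs [i != j] in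
    [1..n].  Expanding a square gives [P = (\sum f k)^2 - \sum f k ^ 2], so the
    two averages have the same numerator and their difference is
    [P * (1/(n(n-1)) - 1/n^2) = P / (n^2 (n-1))].  There are only [n(n-1)]
    off-diagonal pairs, so a bound [M] on [|f|] gives [|P| <= n(n-1) M^2]: the
    factor [n-1] cancels and the difference is at most [M^2 / n] for every [n]
    (lemma [independence_gap_le]).  Both conclusions follow from this single
    explicit estimate. *)

Import Order.TTheory GRing.Theory Num.Theory.
Import numFieldNormedType.Exports.

Local Open Scope ring_scope.

(** The square of a sum is the sum over all pairs of indices; removing the
    diagonal removes the sum of the squares. *)
Lemma sum_offdiag (R : comPzRingType) (f : nat -> R) (m n : nat) :
  \sum_(m <= i < n) \sum_(m <= j < n | j != i) f i * f j =
  (\sum_(m <= k < n) f k) ^+ 2 - \sum_(m <= k < n) f k ^+ 2.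
Proof.
rewrite expr2 big_distrl /= -sumrB.
apply: eq_big_nat => i i_mn.
rewrite big_distrr /= [in RHS](bigD1_seq i) ?iota_uniq ?mem_index_iota //=.
by rewrite expr2 addrC addrK.
Qed.

(** Each term is at most [M ^+ 2], so only the number of off-diagonal pairs is
    needed; [sum_offdiag] for the constant function [M] supplies it. *)
Lemma sum_offdiag_le (R : realDomainType) (f : nat -> R) (M : R) (n : nat) :
  (forall k, (0 < k)%N -> `|f k| <= M) ->
  `|\sum_(1 <= i < n.+1) \sum_(1 <= j < n.+1 | j != i) f i * f j|
    <= M ^+ 2 * (n%:R * (n%:R - 1)).
Proof.
move=> f_le.
have -> : M ^+ 2 * (n%:R * (n%:R - 1)) =
    \sum_(1 <= i < n.+1) \sum_(1 <= j < n.+1 | j != i) M * M.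
  rewrite (sum_offdiag _ (fun=> M)) !sumr_const_nat subn1 /=.
  by rewrite -(mulr_natr M) -(mulr_natr (M ^+ 2)); ring.
apply: (le_trans (ler_norm_sum _ _ _)).
apply: ler_sum_nat => i /andP[i_gt0 _].
apply: (le_trans (ler_norm_sum _ _ _)).
rewrite big_nat_cond [leRHS]big_nat_cond.
apply: ler_sum => j /andP[/andP[j_gt0 _] _].
by rewrite normrM ler_pM ?f_le.
Qed.

(** The denominator [n(n-1)] vanishes for [n <= 1], but the sum over the
    off-diagonal pairs is then empty, so the estimate holds from [n = 0] on. *)
Lemma independence_gap_le (R : realType) (f : nat -> R) (M : R) (n : nat) :
  (forall k, (0 < k)%N -> `|f k| <= M) ->
  `|independence_gap f n| <= M ^+ 2 * (1 / n%:R).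
Proof.
move=> f_le; have P_le := sum_offdiag_le _ _ _ n f_le.
rewrite /independence_gap /average_of_product /product_of_averages.
rewrite -sum_offdiag.
move: (\sum_(_ <= _ < _) _) P_le => P.
case: n => [|[|n]] P_le.
- by rewrite !mul0r expr0n /= !invr0 !mulr0 subrr normr0.
- move: P_le; rewrite subrr !mulr0 normr_le0 => /eqP ->.
  by rewrite !mul0r subrr normr0 mulr_ge0 ?sqr_ge0 ?divr_ge0.
have n1_gt0 : 0 < n.+2%:R - 1 :> R by rewrite subr_gt0 ltr1n.
have n2_gt0 : 0 < n.+2%:R :> R by rewrite ltr0n.
set N : R := n.+2%:R in P_le n1_gt0 n2_gt0 *.
have d_gt0 : 0 < N ^+ 2 * (N - 1) by rewrite mulr_gt0 ?exprn_gt0.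
have -> : P / (N * (N - 1)) - P / N ^+ 2 = P / (N ^+ 2 * (N - 1)).
  by field; rewrite !gt_eqF.
rewrite normrM normfV (gtr0_norm d_gt0) ler_pdivrMr //.
apply: (le_trans P_le); rewrite le_eqVlt; apply/orP; left; apply/eqP.
by field; rewrite gt_eqF.
Qed.

Theorem corollary2 (R : realType) (f : nat -> R) (hf : bounded_arith f) :
  asymptotically_independent_with_exponent f (fun n : nat => 1 / n%:R).
Proof.
have [M [_ M_bound]] := hf.
have f_le k : (0 < k)%N -> `|f k| <= M + 1.
  by apply: M_bound; rewrite ltrDl.
have gap_le n := independence_gap_le _ f (M + 1) n f_le.
split.
- apply: norm_cvg0.
  apply: (@squeeze_cvgr _ _ _ _ (fun=> 0)
    (fun n : nat => (M + 1) ^+ 2 * (1 / n%:R))).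
  + by apply: nearW => n; rewrite normr_ge0 gap_le.
  + exact: cvg_cst.
  + rewrite -(mulr0 ((M + 1) ^+ 2)); apply: cvgMr.
    under eq_fun do rewrite div1r.
    apply/gtr0_cvgV0; last exact: cvgr_idn.
    by exists 1%N => // n /= n_gt0; rewrite ltr0n.
(* The constant of a big-O has to be positive; adding [1] to a square ensures
   this without any knowledge of the sign of [M]. *)
- apply/eqO_exP; exists ((M + 1) ^+ 2 + 1); first by rewrite ltr_wpDl ?sqr_ge0.
  apply: nearW => n; apply: (le_trans (gap_le n)).
  have inv_ge0 : 0 <= 1 / n%:R :> R by rewrite divr_ge0.
  by rewrite ger0_norm // ler_wpM2r // lerDl.
Qed.
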